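(* Suppose each $f_i$ is strongly convex with constant $\mu_i>0$, $i=1,\dots,m$; let $\mu=\min_i\mu_i$ and $L_h=(1/\mu)(2+2\cos(\pi/m))$. Let $h=-g$ and let $\boldsymbol{\lambda}^\star$ be a dual optimal solution, i.e. a maximizer of $g$ over $\mathbb{R}^{n(m-1)}$. Let $\{\boldsymbol{\lambda}^{(k)}\}_{k\ge0}$ be generated by the inexact dual algorithm with distortions satisfying $\|\mathbf{r}_i^{(k)}\|\le\varepsilon_i$ for all $i,k$ and with stepsizes satisfying $0<\gamma_k\le1/L_h$ for all $k\ge0$. Then for every $k\ge0$, $$\min_{i\in\{0,\dots,k\}}\|\nabla h(\boldsymbol{\lambda}^{(i)})\|\le\sqrt{\frac{2\left(h(\boldsymbol{\lambda}^{(0)})-h(\boldsymbol{\lambda}^\star)\right)}{\sum_{i=0}^{k}\gamma_i}}+\epsilon .$$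
   Context: Let $m\ge2$, $n\ge1$ be integers, $\mathcal{Y}\subseteq\mathbb{R}^n$ a nonempty closed convex set, and $f_i:\mathbb{R}^n\to\mathbb{R}$, $i=1,\dots,m$, strictly convex closed functions. For $\mathbf{y}=(\mathbf{y}_1,\dots,\mathbf{y}_m)\in(\mathbb{R}^n)^m=\mathbb{R}^{nm}$ put $f(\mathbf{y})=\sum_{i=1}^m f_i(\mathbf{y}_i)$, let $\bar{\mathcal{Y}}=\mathcal{Y}^m$, and $\mathbf{A}\mathbf{y}=(\mathbf{y}_1-\mathbf{y}_2,\dots,\mathbf{y}_{m-1}-\mathbf{y}_m)\in\mathbb{R}^{n(m-1)}$. The dual function is $g(\boldsymbol{\lambda})=\inf_{\mathbf{y}\in\bar{\mathcal{Y}}}\big[f(\mathbf{y})+\boldsymbol{\lambda}^{T}\mathbf{A}\mathbf{y}\big]$, $\boldsymbol{\lambda}\in\mathbb{R}^{n(m-1)}$; when all $f_i$ are strongly convex, $g$ is differentiable. Inexact dual algorithm: start from any $\boldsymbol{\lambda}^{(0)}\in\mathbb{R}^{n(m-1)}$; for $k=0,1,2,\dots$ let $\mathbf{y}^{(k)}=\arg\min_{\mathbf{y}\in\bar{\mathcal{Y}}}\big[f(\mathbf{y})+(\boldsymbol{\lambda}^{(k)})^{T}\mathbf{A}\mathbf{y}\big]$, let $\hat{\mathbf{y}}_i^{(k)}=\mathbf{y}_i^{(k)}+\mathbf{r}_i^{(k)}$ where $\mathbf{r}_i^{(k)}\in\mathbb{R}^n$ are arbitrary distortions, let $\hat{\mathbf{d}}^{(k)}=\mathbf{A}\hat{\mathbf{y}}^{(k)}$,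 and set $\boldsymbol{\lambda}^{(k+1)}=\boldsymbol{\lambda}^{(k)}+\gamma_k\hat{\mathbf{d}}^{(k)}$. The distortions are bounded by constants: $\|\mathbf{r}_i^{(k)}\|\le\varepsilon_i$ for all $i$ and $k$, and $\epsilon:=\sqrt{\sum_{i=1}^{m-1}(\varepsilon_i+\varepsilon_{i+1})^2}$. Norms are Euclidean. A function $\varphi$ is strongly convex with constant $\sigma>0$ if $\varphi-\frac{\sigma}{2}\|\cdot\|^2$ is convex. *)

(* Defs.v *)
From HB Require Import structures.
From mathcomp Require Import all_boot all_order all_algebra.
From mathcomp Require Import all_classical all_reals all_analysis.

Set Implicit Arguments.
Unset Strict Implicit.
Unset Printing Implicit Defensive.

Import Order.TTheory GRing.Theory Num.Theory.
Import numFieldNormedType.Exports.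

Local Open Scope classical_set_scope.
Local Open Scope ring_scope.

(* The number of agents is m = p.+1. A point (y_1, ..., y_m) of (R^n)^m is the
   matrix whose i-th row is y_i, and a multiplier in R^(n(m-1)) is a p x n
   matrix, so that the Euclidean structure on matrices is entrywise. *)

Definition dotmx (R : realType) (q n : nat) (x y : 'M[R]_(q, n)) : R :=
  \sum_(i < q) \sum_(j < n) x i j * y i j.

(* The library norm `|x| on matrices is the sup norm; it only provides the
   topology here. *)
Definition enorm (R : realType) (q n : nat) (x : 'M[R]_(q, n)) : R :=
  Num.sqrt (dotmx x x).

Definition strictly_convex (R : realType) (n : nat) (f : 'rV[R]_n -> R) :=
  forall (x y : 'rV[R]_n) (t : R), x != y -> 0 < t -> t < 1 ->
    f (t *: x + (1 - t) *: y) < t * f x + (1 - t) * f y.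

Definition closed_function (R : realType) (n : nat) (f : 'rV[R]_n -> R) :=
  closed [set z : 'rV[R]_n * R | f z.1 <= z.2].

Definition strongly_convex (R : realType) (n : nat) (sigma : R)
    (f : 'rV[R]_n -> R) :=
  convex_function setT (fun x : 'rV[R]_n => f x - sigma / 2 * enorm x ^+ 2).

Definition prod_set (R : realType) (p n : nat) (Y : set 'rV[R]_n) :
    set 'M[R]_(p.+1, n) :=
  [set y | forall i, Y (row i y)].

Definition sum_fun (R : realType) (p n : nat)
    (f : 'I_p.+1 -> 'rV[R]_n -> R) (y : 'M[R]_(p.+1, n)) : R :=
  \sum_(i < p.+1) f i (row i y).

Definition cur (p : nat) (i : 'I_p) : 'I_p.+1 := widen_ord (leqnSn p) i.
Definition nxt (p : nat) (i : 'I_p) : 'I_p.+1 := lift ord0 i.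

Definition Amap (R : realType) (p n : nat) (y : 'M[R]_(p.+1, n)) :
    'M[R]_(p, n) :=
  \matrix_(i < p) (row (cur i) y - row (nxt i) y).

Definition lagrangian (R : realType) (p n : nat)
    (f : 'I_p.+1 -> 'rV[R]_n -> R) (lam : 'M[R]_(p, n))
    (y : 'M[R]_(p.+1, n)) : R :=
  sum_fun f y + dotmx lam (Amap y).

(* A real infimum: the set of values is nonempty and bounded below whenever Y is
   nonempty and every f i is strongly convex. *)
Definition dual_fun (R : realType) (p n : nat) (Y : set 'rV[R]_n)
    (f : 'I_p.+1 -> 'rV[R]_n -> R) (lam : 'M[R]_(p, n)) : R :=
  inf (lagrangian f lam @` prod_set Y).

Definition is_argmin (R : realType) (T : Type) (D : set T) (F : T -> R) (x : T) :=
  D x /\ forall z, D z -> F x <= F z.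

Definition gradient (R : realType) (q n : nat) (h : 'M[R]_(q, n) -> R)
    (x : 'M[R]_(q, n)) : 'M[R]_(q, n) :=
  \matrix_(i < q, j < n) ('d (h : _ -> R^o) x (delta_mx i j) : R).

Definition inexact_dual_run (R : realType) (p n : nat) (Y : set 'rV[R]_n)
    (f : 'I_p.+1 -> 'rV[R]_n -> R) (gamma : nat -> R)
    (r y : nat -> 'M[R]_(p.+1, n)) (lam : nat -> 'M[R]_(p, n)) :=
  forall k,
    is_argmin (prod_set Y) (lagrangian f (lam k)) (y k) /\
    lam k.+1 = lam k + gamma k *: Amap (y k + r k).

Definition total_distortion (R : realType) (p : nat) (eps : 'I_p.+1 -> R) : R :=
  Num.sqrt (\sum_(i < p) (eps (cur i) + eps (nxt i)) ^+ 2).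

Definition min_mu (R : realType) (p : nat) (mu : 'I_p.+1 -> R) : R :=
  \big[Num.min/mu ord0]_(i < p.+1) mu i.

Definition Lh (R : realType) (p : nat) (mu : 'I_p.+1 -> R) : R :=
  1 / min_mu mu * (2 + 2 * cos (pi / p.+1%:R)).

(* Main.v *)
From Pilot Require Import Defs.
From HB Require Import structures.
From mathcomp Require Import all_boot all_order all_algebra.
From mathcomp Require Import all_classical all_reals all_analysis.
From mathcomp Require Import ring lra.

Set Implicit Arguments.
Unset Strict Implicit.
Unset Printing Implicit Defensive.

Import Order.TTheory GRing.Theory Num.Theory.
Import numFieldNormedType.Exports.

Local Open Scope classical_set_scope.
Local Open Scope ring_scope.

(** At [lam k] the Lagrangian has a minimizer [y k] over the feasible set, around
    which it grows at least like [min_mu mu / 2 * |z - y k|^2]. Combined with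
    [|A z|^2 <= (2 + 2 cos (pi / m)) |z|^2], this squeezes the dual function
    between an affine function of slope [A (y k)] and the same function minus
    [Lh mu / 2 * |d|^2]. Hence [- A (y k)] is the gradient of [h] at [lam k], and
    the step [gamma k <= 1 / Lh mu] along [A (y k) + A (r k)] decreases [h] by at
    least [gamma k / 2 * (|A (y k)|^2 - |A (r k)|^2)]; summing over the steps
    gives the bound. *)

(* [dotmx] is also a name of the imported sesquilinear-form theory. *)
Local Notation dotmx := Pilot.Defs.dotmx.

(** * Euclidean inner product and norm on matrices *)

Section Euclidean.
Variables (R : realType) (q n : nat).
Implicit Types (x y z : 'M[R]_(q, n)) (a : R).

Lemma dotmxC x y : dotmx x y = dotmx y x.
Proof. by do 2!apply: eq_bigr => ? _; rewrite mulrC. Qed.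

Lemma dotmx_linear x a y z :
  dotmx x (a *: y + z) = a * dotmx x y + dotmx x z.
Proof.
rewrite /dotmx mulr_sumr -big_split; apply: eq_bigr => i _ /=.
rewrite mulr_sumr -big_split; apply: eq_bigr => j _ /=.
by rewrite !mxE; ring.
Qed.

Lemma dotmxDr x y z : dotmx x (y + z) = dotmx x y + dotmx x z.
Proof. by rewrite -[y]scale1r dotmx_linear mul1r scale1r. Qed.

Lemma dotmxZr x a y : dotmx x (a *: y) = a * dotmx x y.
Proof.
have x0 : dotmx x 0 = 0.
  by rewrite /dotmx big1// => i _; rewrite big1// => j _; rewrite mxE mulr0.
by rewrite -[a *: y]addr0 dotmx_linear x0 addr0.
Qed.

Lemma dotmxNr x y : dotmx x (- y) = - dotmx x y.
Proof. by rewrite -scaleN1r dotmxZr mulN1r. Qed.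

Lemma dotmxDl x y z : dotmx (x + y) z = dotmx x z + dotmx y z.
Proof. by rewrite !(dotmxC _ z) dotmxDr. Qed.

Lemma dotmxZl a x y : dotmx (a *: x) y = a * dotmx x y.
Proof. by rewrite !(dotmxC _ y) dotmxZr. Qed.

Lemma dotmxNl x y : dotmx (- x) y = - dotmx x y.
Proof. by rewrite !(dotmxC _ y) dotmxNr. Qed.

Definition dotmx_bilinE := (dotmxDl, dotmxDr, dotmxNl, dotmxNr, dotmxZl, dotmxZr).

Lemma dotmx_ge0 x : 0 <= dotmx x x.
Proof. by do 2!apply: sumr_ge0 => ? _; rewrite -expr2 sqr_ge0. Qed.

Lemma enorm_ge0 x : 0 <= enorm x.
Proof. exact: sqrtr_ge0. Qed.

Lemma enorm_sqr x : enorm x ^+ 2 = dotmx x x.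
Proof. by rewrite sqr_sqrtr ?dotmx_ge0. Qed.

(** Divide [0 <= |a x + y|^2] by [2 a]. *)
Lemma dotmx_young x y a : 0 < a ->
  - dotmx x y <= a / 2 * dotmx x x + (2 * a)^-1 * dotmx y y.
Proof.
move=> a0; have := dotmx_ge0 (a *: x + y).
rewrite !dotmx_bilinE (dotmxC y x) => H.
rewrite -subr_ge0.
set e := (X in 0 <= X).
suff -> : e = (2 * a)^-1 * (a * (a * dotmx x x + dotmx x y) + (a * dotmx x y + dotmx y y)).
  by apply: mulr_ge0; [rewrite invr_ge0; lra|lra].
by rewrite /e; field; lra.
Qed.

Lemma dotmx_sqr_le x y : dotmx x y ^+ 2 <= dotmx x x * dotmx y y.
Proof.
have := dotmx_ge0 y; rewrite le_eqVlt => /predU1P[y0|y0].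
  have [->|xy0] := eqVneq (dotmx x y) 0; first by rewrite -y0 mulr0 expr0n.
  (* As [dotmx y y = 0], this multiple of [y] makes the squared norm equal to -1. *)
  have := dotmx_ge0 (x - ((dotmx x x + 1) / (2 * dotmx x y)) *: y).
  rewrite !dotmx_bilinE -y0 (dotmxC y x).
  set e := (X in 0 <= X).
  by have -> : e = - 1 by [rewrite /e; field]; lra.
(* The squared norm of this vector is [dotmx y y] times the Cauchy-Schwarz gap. *)
have := dotmx_ge0 (dotmx y y *: x - dotmx x y *: y).
rewrite !dotmx_bilinE (dotmxC y x) => H.
rewrite -subr_ge0 -(pmulr_rge0 _ y0); nra.
Qed.

Lemma dotmx_le_enorm x y : dotmx x y <= enorm x * enorm y.
Proof.
apply: le_trans (ler_norm _) _.
rewrite -sqrtr_sqr /enorm -sqrtrM ?dotmx_ge0// ler_sqrt ?dotmx_sqr_le//.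
by rewrite mulr_ge0 ?dotmx_ge0.
Qed.

Lemma enormN x : enorm (- x) = enorm x.
Proof. by rewrite /enorm !dotmx_bilinE opprK. Qed.

Lemma enormB_le x y : enorm (x - y) <= enorm x + enorm y.
Proof.
rewrite -(@ler_pXn2r _ 2) ?nnegrE ?addr_ge0 ?enorm_ge0// sqrrD !enorm_sqr.
have := dotmx_le_enorm (- x) y; rewrite enormN !dotmx_bilinE (dotmxC y x); lra.
Qed.

End Euclidean.

Lemma dotmx_row (R : realType) q n (x y : 'M[R]_(q, n)) :
  dotmx x y = \sum_(i < q) dotmx (row i x) (row i y).
Proof.
apply: eq_bigr => i _; rewrite /dotmx big_ord1.
by apply: eq_bigr => j _; rewrite !mxE.
Qed.

Lemma dotmx_col (R : realType) q n (x y : 'M[R]_(q, n)) :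
  dotmx x y = \sum_(j < n) \sum_(i < q) x i j * y i j.
Proof. exact: exchange_big. Qed.

(** * The norm of the difference operator *)

Section Difference.
Variables (R : realType) (p : nat).

Let theta : R := pi / p.+1%:R.
Let s (i : nat) : R := sin (theta / 2 + theta *+ i).
Let b (i : nat) : R := s i.+1 / s i.

(* [s] is, up to alternating signs, the top singular vector of the difference
   operator on [p.+1] points. *)
Let s_gt0 (i : nat) : (i <= p)%N -> 0 < s i.
Proof.
move=> ip; have pi0 := pi_gt0 R.
have th0 : 0 < theta by rewrite divr_gt0.
have thp : pi = theta *+ p.+1 by rewrite -mulr_natr divfK.
apply: sin_gt0_pi; rewrite thp; apply/andP; split.
  by rewrite ltr_pwDl ?mulrn_wge0 ?ltW//; lra.
have : theta *+ i <= theta *+ p by rewrite ler_pMn2l.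
rewrite (mulrS _ p); lra.
Qed.

Let s_rec (i : nat) : s i.+2 + s i = 2 * cos theta * s i.+1.
Proof.
rewrite /s.
have -> : theta / 2 + theta *+ i.+2 = (theta / 2 + theta *+ i.+1) + theta.
  by rewrite (mulrS _ i.+1); ring.
have -> : theta / 2 + theta *+ i = (theta / 2 + theta *+ i.+1) - theta.
  by rewrite (mulrS _ i); ring.
by rewrite sinD sinB; ring.
Qed.

(** Left boundary: extended to index -1, the sine sequence takes the value [- s 0]. *)
Let b0 : b 0 = 1 + 2 * cos theta.
Proof.
have s0 : s 0 != 0 by rewrite gt_eqF ?s_gt0.
apply: (mulIf s0); rewrite divfK//.
have E : s 0 = sin (theta / 2) by rewrite /s mulr0n addr0.
have : s 1 = sin (theta / 2 + theta) by rewrite /s mulr1n.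
rewrite sinD E => ->.
have -> : cos theta = cos (theta / 2 + theta / 2) by congr cos; lra.
have -> : sin theta = sin (theta / 2 + theta / 2) by congr sin; lra.
rewrite cosD sinD; have := cos2Dsin2 (theta / 2).
set u := cos _; set v := sin _ => uv.
have -> : u * (v * u + u * v) = 2 * v * (u * u) by ring.
have -> : u * u = 1 - v * v by rewrite -!expr2 -uv; ring.
ring.
Qed.

Let b_rec (i : nat) : (i < p)%N -> s i / s i.+1 = 2 * cos theta - b i.+1.
Proof.
move=> ip; have s0 : s i.+1 != 0 by rewrite gt_eqF ?s_gt0.
by rewrite /b -[2 * cos _](mulfK s0) -s_rec; field.
Qed.

(** Right boundary: [s p] and [s p.+1] are the sines of [pi - theta / 2] and [pi + theta / 2]. *)
Let b_last : b p = -1.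
Proof.
have sp : s p != 0 by rewrite gt_eqF ?s_gt0.
apply: (mulIf sp); rewrite divfK// mulN1r.
have thp : pi = theta *+ p.+1 by rewrite -mulr_natr divfK.
have -> : s p.+1 = sin (theta / 2 + pi) by rewrite thp.
have -> : s p = sin (pi - theta / 2).
  by rewrite thp /s (mulrS _ p); congr sin; lra.
by rewrite sinB sinD sinpi cospi; ring.
Qed.

Let young (a c u v : R) : 0 < u -> 0 < v ->
  (a - c) ^+ 2 <= a ^+ 2 * (1 + v / u) + c ^+ 2 * (1 + u / v).
Proof.
move=> u0 v0; rewrite -subr_ge0.
set e := (X in 0 <= X); suff -> : e = (a * v + c * u) ^+ 2 / (u * v).
  by rewrite divr_ge0 ?sqr_ge0// mulr_ge0 ?ltW.
by rewrite /e; field; rewrite !gt_eqF.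
Qed.

(** Each difference is split by [young] with weights [s i] and [s i.+1]. By [b_rec] the two
    contributions to an interior [a i ^+ 2] add up to [2 + 2 * cos theta]; [b0] and [b_last] give
    the same total at the ends. *)
Lemma sum_sqr_diff_le (a : nat -> R) :
  \sum_(i < p) (a i - a i.+1) ^+ 2 <=
  (2 + 2 * cos theta) * \sum_(i < p.+1) a i ^+ 2.
Proof.
(* The subtracted term is the share of [a k ^+ 2] reserved for the next difference; it vanishes at
   [k = p]. *)
suff H k : (k <= p)%N -> \sum_(i < k) (a i - a i.+1) ^+ 2 <=
    (2 + 2 * cos theta) * (\sum_(i < k.+1) a i ^+ 2) - a k ^+ 2 * (1 + b k).
  by have := H p (leqnn p); rewrite b_last subrr mulr0 subr0.
elim: k => [_|k IH kp]; first by rewrite big_ord0 big_ord1 b0; lra.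
rewrite big_ord_recr big_ord_recr /=.
have := young (a k) (a k.+1) (s_gt0 (ltnW kp)) (s_gt0 kp).
rewrite b_rec// -/(b k); have := IH (ltnW kp); nra.
Qed.

End Difference.

Lemma Amap_linear (R : realType) p n a (y z : 'M[R]_(p.+1, n)) :
  Amap (a *: y + z) = a *: Amap y + Amap z.
Proof. by apply/matrixP => i j; rewrite !mxE; ring. Qed.

Lemma AmapZ (R : realType) p n a (y : 'M[R]_(p.+1, n)) :
  Amap (a *: y) = a *: Amap y.
Proof. by apply/matrixP => i j; rewrite !mxE mulrBr. Qed.

Lemma AmapD (R : realType) p n (y z : 'M[R]_(p.+1, n)) :
  Amap (y + z) = Amap y + Amap z.
Proof. by rewrite -[y]scale1r Amap_linear !scale1r. Qed.

Lemma AmapB (R : realType) p n (y z : 'M[R]_(p.+1, n)) :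
  Amap (y - z) = Amap y - Amap z.
Proof. by rewrite addrC -scaleN1r Amap_linear scaleN1r addrC. Qed.

Lemma dotmx_Amap_le (R : realType) p n (z : 'M[R]_(p.+1, n)) :
  dotmx (Amap z) (Amap z) <= (2 + 2 * cos (pi / p.+1%:R)) * dotmx z z.
Proof.
rewrite !dotmx_col mulr_sumr; apply: ler_sum => j _.
(* [Amap] acts on each column separately; [inord] is evaluated only at indices up to [p], where it
   is exact. *)
have := sum_sqr_diff_le p (fun k => z (inord k) j).
set S1 := \sum_(i < p) _; set S2 := \sum_(i < p.+1) _.
have -> : S1 = \sum_(i < p) Amap z i j * Amap z i j.
  apply: eq_bigr => i _; rewrite !mxE -expr2; congr ((z _ _ - z _ _) ^+ 2).
    by apply: val_inj; rewrite /= inordK// ltnS ltnW.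
  by apply: val_inj; rewrite /= inordK// ltnS.
by have -> : S2 = \sum_(i < p.+1) z i j * z i j
  by apply: eq_bigr => i _; rewrite inord_val expr2.
Qed.

(** * Gradients from quadratic expansions *)

Section Gradient.
Variables (R : realType) (q n : nat).

Lemma entry_le_norm (x : 'M[R]_(q, n)) i j : `|x i j| <= `|x|.
Proof.
by rewrite [leRHS]/Num.Def.normr/= mx_normrE; exact: (le_bigmax _ _ (i, j)).
Qed.

Lemma dotmx_le_norm (x : 'M[R]_(q, n)) :
  dotmx x x <= (q * n)%:R * `|x| ^+ 2.
Proof.
apply: (@le_trans _ _ (\sum_(i < q) \sum_(j < n) `|x| ^+ 2)); last first.
  by rewrite !sumr_const !card_ord -mulrnA mulnC mulr_natl.
do 2!apply: ler_sum => ? _.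
rewrite -expr2 -real_normK ?num_real// lerXn2r ?nnegrE ?normr_ge0//.
exact: entry_le_norm.
Qed.

Definition dotmxr (g x : 'M[R]_(q, n)) : R^o := dotmx g x.

Lemma dotmxr_is_linear g : linear (dotmxr g).
Proof. by move=> a x y; exact: dotmx_linear. Qed.

HB.instance Definition _ g :=
  GRing.isLinear.Build R 'M[R]_(q, n) R^o _ (dotmxr g) (dotmxr_is_linear g).

Lemma continuous_dotmxr g : continuous (dotmxr g).
Proof.
apply/linear_bounded_continuous/bounded_funP => r.
exists (\sum_(i < q) \sum_(j < n) `|g i j| * r) => x xr.
apply: le_trans (ler_norm_sum _ _ _) _; apply: ler_sum => i _.
apply: le_trans (ler_norm_sum _ _ _) _; apply: ler_sum => j _.
by rewrite normrM ler_wpM2l// (le_trans (entry_le_norm _ _ _)).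
Qed.

(** A quadratic error is negligible against [|d|], so [dotmx g] is the differential by uniqueness,
    and its values on the matrices [delta_mx i j] are the entries of [g]. *)
Lemma gradient_quadratic (h : 'M[R]_(q, n) -> R) (x g : 'M[R]_(q, n)) (C : R) :
  (forall d, `|h (x + d) - h x - dotmx g d| <= C * dotmx d d) ->
  gradient h x = g.
Proof.
move=> hC.
have dh : 'd (h : _ -> R^o) x = dotmxr g :> (_ -> _).
  apply: diff_unique; first exact: continuous_dotmxr.
  apply/eqaddoP => _/posnumP[e]; near=> d.
  rewrite -[X in `|X|]/(h (d + x) - (h x + dotmx g d)) opprD addrA (addrC d).
  apply: le_trans (hC d) _.
  have K0 : 0 <= `|C| * (q * n)%:R by rewrite mulr_ge0.
  apply: (@le_trans _ _ ((`|C| * (q * n)%:R) * `|d| * `|d|)).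
    apply: (@le_trans _ _ (`|C| * dotmx d d)).
      by rewrite ler_wpM2r ?dotmx_ge0 ?ler_norm.
    by rewrite -!mulrA -expr2 ler_wpM2l ?normr_ge0 ?dotmx_le_norm.
  rewrite ler_wpM2r//.
  (* Adding 1 makes the factor positive, so that [e] can be divided by it. *)
  apply: (@le_trans _ _ ((`|C| * (q * n)%:R + 1) * `|d|)).
    by rewrite ler_wpM2r// lerDl.
  rewrite -ler_pdivlMl; last by rewrite ltr_wpDl.
  apply: ltW; near: d; apply: cvgr0_norm_lt; first exact: cvg_id.
  by rewrite mulr_gt0// invr_gt0 ltr_wpDl.
apply/matrixP => i j; rewrite mxE dh /dotmxr /Pilot.Defs.dotmx.
rewrite (bigD1 i)//= (bigD1 j)//= mxE !eqxx mulr1.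
rewrite big1 ?addr0 => [|k kj]; last by rewrite mxE (negPf kj) andbF mulr0.
rewrite big1 ?addr0// => k ki; rewrite big1// => l _.
by rewrite mxE (negPf ki) mulr0.
Unshelve. all: by end_near. Qed.

End Gradient.

(** * Quadratic expansion of the dual function *)

(** The last term comes from [t |x|^2 + (1 - t) |y|^2 - |t x + (1 - t) y|^2 = t (1 - t) |x -
    y|^2]. *)
Lemma strongly_convex_le (R : realType) n (sigma : R) (f : 'rV[R]_n -> R)
    (x y : 'rV[R]_n) (t : R) :
  strongly_convex sigma f -> 0 <= t -> t <= 1 ->
  f (t *: x + (1 - t) *: y) <= t * f x + (1 - t) * f y
     - sigma / 2 * (t * (1 - t)) * dotmx (x - y) (x - y).
Proof.
move=> fs t0 t1.
have := fs (Itv01 t0 t1) x y (in_setT _) (in_setT _).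
rewrite convRE /= -[X in f X]/(t *: x + (1 - t) *: y).
rewrite -[X in enorm X]/(t *: x + (1 - t) *: y).
rewrite !enorm_sqr !dotmx_bilinE (dotmxC y x) -[unstable.onem t]/(1 - t); lra.
Qed.

Lemma min_mu_le (R : realType) p (mu : 'I_p.+1 -> R) i : min_mu mu <= mu i.
Proof. exact: bigmin_le. Qed.

Lemma min_mu_gt0 (R : realType) p (mu : 'I_p.+1 -> R) :
  (forall i, 0 < mu i) -> 0 < min_mu mu.
Proof. by move=> mu0; apply: lt_bigmin. Qed.

Lemma cos_pi_div_ge0 (R : realType) p : (2 <= p.+1)%N ->
  0 <= cos (pi / p.+1%:R : R).
Proof.
move=> p2; have pi0 := pi_gt0 R; apply: cos_ge0_pihalf; apply/andP; split.
  by apply: (@le_trans _ _ 0); [lra|rewrite divr_ge0// ltW].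
by rewrite ler_pM2l// lef_pV2 ?posrE ?ltr0n// ler_nat.
Qed.

Lemma Lh_gt0 (R : realType) p (mu : 'I_p.+1 -> R) : (2 <= p.+1)%N ->
  (forall i, 0 < mu i) -> 0 < Lh mu.
Proof.
move=> p2 mu0; rewrite mulr_gt0 ?divr_gt0 ?min_mu_gt0//.
by have := cos_pi_div_ge0 R p2; lra.
Qed.

Section Dual.
Variables (R : realType) (p n : nat) (Y : set 'rV[R]_n).
Hypotheses (p_ge1 : (2 <= p.+1)%N) (Y_convex : convex_set Y).
Variables (f : 'I_p.+1 -> 'rV[R]_n -> R) (mu : 'I_p.+1 -> R).
Hypotheses (mu_gt0 : forall i, 0 < mu i)
  (f_strong : forall i, strongly_convex (mu i) (f i)).

Lemma prod_set_convex (x y : 'M[R]_(p.+1, n)) (t : R) : 0 <= t -> t <= 1 ->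
  prod_set Y x -> prod_set Y y -> prod_set Y (t *: x + (1 - t) *: y).
Proof.
move=> t0 t1 Yx Yy i.
have := Y_convex (Itv01 t0 t1) (mem_set (Yx i)) (mem_set (Yy i)).
by rewrite inE linearD !linearZ.
Qed.

(** The coupling term is linear in the point and cancels; the strong convexity of the rows is
    summed, each modulus being lowered to the minimum. *)
Lemma lagrangian_convex_le l (x y : 'M[R]_(p.+1, n)) (t : R) :
  0 <= t -> t <= 1 ->
  lagrangian f l (t *: x + (1 - t) *: y) <=
    t * lagrangian f l x + (1 - t) * lagrangian f l y
    - min_mu mu / 2 * (t * (1 - t)) * dotmx (x - y) (x - y).
Proof.
move=> t0 t1.
have fE : sum_fun f (t *: x + (1 - t) *: y) <=
    t * sum_fun f x + (1 - t) * sum_fun f y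
    - min_mu mu / 2 * (t * (1 - t)) * dotmx (x - y) (x - y).
  rewrite (dotmx_row (x - y)) /sum_fun !mulr_sumr -big_split/= -sumrB.
  apply: ler_sum => i _.
  have -> : row i (t *: x + (1 - t) *: y) = t *: row i x + (1 - t) *: row i y.
    by rewrite linearD !linearZ.
  rewrite [row i (x - y)]linearB.
  apply: le_trans (strongly_convex_le _ _ (f_strong i) t0 t1) _.
  rewrite lerD2l lerN2 ler_wpM2r ?dotmx_ge0// ler_wpM2r ?mulr_ge0 ?subr_ge0//.
  by rewrite ler_wpM2r// min_mu_le.
move: fE; rewrite /lagrangian Amap_linear AmapZ !dotmx_bilinE; lra.
Qed.

(* Compare the minimizer with points of the segment towards [z] and let these
   tend to the minimizer. *)
Lemma argmin_quadratic_growth l (y z : 'M[R]_(p.+1, n)) :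
  is_argmin (prod_set Y) (lagrangian f l) y -> prod_set Y z ->
  lagrangian f l y + min_mu mu / 2 * dotmx (z - y) (z - y) <= lagrangian f l z.
Proof.
move=> [Yy ymin] Yz.
set B := min_mu mu / 2 * _.
have B0 : 0 <= B by rewrite mulr_ge0 ?dotmx_ge0// divr_ge0// ltW ?min_mu_gt0.
have H t : 0 < t -> t <= 1 -> (1 - t) * B <= lagrangian f l z - lagrangian f l y.
  move=> t0 t1; rewrite -(ler_pM2l t0).
  have := lagrangian_convex_le l z y (ltW t0) t1.
  have := ymin _ (prod_set_convex (ltW t0) t1 Yz Yy).
  rewrite /B; lra.
have zy := ymin _ Yz.
apply: contrapT => /negP; rewrite -ltNge => zB.
have B1 : 0 < B by lra.
set D := lagrangian f l z - lagrangian f l y in H.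
have D0 : 0 <= D by rewrite /D; lra.
have BD : 0 < B - D by rewrite /D; lra.
(* For this [t], [(1 - t) * B] is the midpoint of [D] and [B], hence exceeds [D]. *)
have t0 : 0 < (B - D) / (2 * B) by rewrite divr_gt0// mulr_gt0.
have t1 : (B - D) / (2 * B) <= 1 by rewrite ler_pdivrMr; lra.
have := H _ t0 t1.
have -> : (1 - (B - D) / (2 * B)) * B = (B + D) / 2 by field; lra.
lra.
Qed.

Lemma lagrangianD l d (y : 'M[R]_(p.+1, n)) :
  lagrangian f (l + d) y = lagrangian f l y + dotmx d (Amap y).
Proof. by rewrite /lagrangian dotmxDl addrA. Qed.

(** Young's inequality with weight [Lh mu] bounds [d . A (z - y)] at the cost of
    [|A (z - y)|^2 / (2 Lh mu)]. The quadratic growth around [y] pays for it, because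
    [Lh mu * min_mu mu] is the constant of [dotmx_Amap_le]. *)
Lemma lagrangian_ge l d (y z : 'M[R]_(p.+1, n)) :
  is_argmin (prod_set Y) (lagrangian f l) y -> prod_set Y z ->
  lagrangian f l y + dotmx d (Amap y) - Lh mu / 2 * dotmx d d
    <= lagrangian f (l + d) z.
Proof.
move=> ymin Yz; have := argmin_quadratic_growth ymin Yz.
have L0 := Lh_gt0 p_ge1 mu_gt0; have m0 := min_mu_gt0 mu_gt0.
have := dotmx_young d (Amap (z - y)) L0.
have : (2 * Lh mu)^-1 * dotmx (Amap (z - y)) (Amap (z - y)) <=
    min_mu mu / 2 * dotmx (z - y) (z - y).
  rewrite ler_pdivrMl; last by lra.
  apply: le_trans (dotmx_Amap_le _) _.
  rewrite mulrA ler_wpM2r ?dotmx_ge0// /Lh le_eqVlt; apply/orP; left.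
  by apply/eqP; field; lra.
rewrite lagrangianD AmapB !dotmx_bilinE; lra.
Qed.

Lemma dual_fun_bounds l d (y : 'M[R]_(p.+1, n)) :
  is_argmin (prod_set Y) (lagrangian f l) y ->
  lagrangian f l y + dotmx d (Amap y) - Lh mu / 2 * dotmx d d
    <= dual_fun Y f (l + d) <= lagrangian f l y + dotmx d (Amap y).
Proof.
move=> ymin; have [Yy _] := ymin; apply/andP; split.
  apply: lb_le_inf; first by exists (lagrangian f (l + d) y), y.
  by move=> _ [z Yz <-]; exact: lagrangian_ge.
rewrite -lagrangianD; apply: ge_inf; last by exists y.
(* [ge_inf] asks for a set bounded below; the lower estimate supplies the bound. *)
exists (lagrangian f l y + dotmx d (Amap y) - Lh mu / 2 * dotmx d d).
by move=> _ [z Yz <-]; exact: lagrangian_ge.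
Qed.

(** At [d = 0] the two bounds coincide. *)
Lemma dual_fun_argmin l (y : 'M[R]_(p.+1, n)) :
  is_argmin (prod_set Y) (lagrangian f l) y ->
  dual_fun Y f l = lagrangian f l y.
Proof.
move=> /(@dual_fun_bounds l 0 y); rewrite addr0 -(scale0r 0) !dotmx_bilinE.
by rewrite !mul0r mulr0 subr0 addr0 => /le_anti.
Qed.

Lemma gradient_dual_fun l (y : 'M[R]_(p.+1, n)) :
  is_argmin (prod_set Y) (lagrangian f l) y ->
  gradient (fun l' => - dual_fun Y f l') l = - Amap y.
Proof.
move=> ymin; apply: (@gradient_quadratic _ _ _ _ _ _ (Lh mu / 2)) => d.
have /andP[lb ub] := dual_fun_bounds d ymin.
rewrite (dual_fun_argmin ymin) dotmxNl (dotmxC (Amap y)) ler_norml.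
have : 0 <= Lh mu / 2 * dotmx d d.
  by rewrite mulr_ge0 ?dotmx_ge0// divr_ge0// ltW ?Lh_gt0.
by move=> ?; apply/andP; split; lra.
Qed.

(** Put [a = A y] and [e = A r]. The lower bound at displacement [gam (a + e)], with
    [Lh mu * gam <= 1], gives a gain of at least [gam (a . (a + e) - |a + e|^2 / 2)], which equals
    [gam / 2 * (|a|^2 - |e|^2)]. *)
Lemma inexact_step_descent l (y r : 'M[R]_(p.+1, n)) (gam : R) :
  is_argmin (prod_set Y) (lagrangian f l) y -> 0 < gam -> gam <= 1 / Lh mu ->
  gam * (dotmx (Amap y) (Amap y) - dotmx (Amap r) (Amap r)) <=
  2 * (dual_fun Y f (l + gam *: Amap (y + r)) - dual_fun Y f l).
Proof.
move=> ymin g0 gL; have L0 := Lh_gt0 p_ge1 mu_gt0.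
have /andP[lb _] := dual_fun_bounds (gam *: Amap (y + r)) ymin.
have Lg : Lh mu * gam <= 1 by rewrite mulrC -ler_pdivlMr.
rewrite (dual_fun_argmin ymin).
have := ler_wpM2r (mulr_ge0 (ltW g0) (dotmx_ge0 (Amap (y + r)))) Lg.
move: lb; rewrite !AmapD !dotmx_bilinE (dotmxC (Amap r) (Amap y)); nra.
Qed.

End Dual.

(** * Distortion bound and summation over the steps *)

Lemma enorm_Amap_le (R : realType) p n (r : 'M[R]_(p.+1, n)) (eps : 'I_p.+1 -> R) :
  (forall i, enorm (row i r) <= eps i) -> enorm (Amap r) <= total_distortion eps.
Proof.
move=> reps; have eps0 i : 0 <= eps i := le_trans (enorm_ge0 _) (reps i).
rewrite /total_distortion ler_sqrt; last by apply: sumr_ge0 => i _; exact: sqr_ge0.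
rewrite dotmx_row; apply: ler_sum => i _; rewrite rowK -enorm_sqr.
rewrite lerXn2r ?nnegrE ?enorm_ge0 ?addr_ge0//.
by apply: le_trans (enormB_le _ _) _; exact: lerD.
Qed.

Theorem lemma2 (R : realType) (p n : nat)
    (hm : (2 <= p.+1)%N) (hn : (1 <= n)%N)
    (Y : set 'rV[R]_n) (Y_nonempty : Y !=set0) (Y_closed : closed Y)
    (Y_convex : convex_set Y)
    (f : 'I_p.+1 -> 'rV[R]_n -> R)
    (f_strict : forall i, strictly_convex (f i))
    (f_closed : forall i, closed_function (f i))
    (mu : 'I_p.+1 -> R) (mu_gt0 : forall i, 0 < mu i)
    (f_strong : forall i, strongly_convex (mu i) (f i))
    (lam_star : 'M[R]_(p, n))
    (lam_star_opt : forall l, dual_fun Y f l <= dual_fun Y f lam_star)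
    (eps : 'I_p.+1 -> R) (gamma : nat -> R)
    (r y : nat -> 'M[R]_(p.+1, n)) (lam : nat -> 'M[R]_(p, n))
    (r_bound : forall k i, enorm (row i (r k)) <= eps i)
    (gamma_bound : forall k, 0 < gamma k /\ gamma k <= 1 / Lh mu)
    (run : inexact_dual_run Y f gamma r y lam) (k : nat) :
  let h := fun l : 'M[R]_(p, n) => - dual_fun Y f l in
  \big[Num.min/enorm (gradient h (lam 0%N))]_(i < k.+1)
      enorm (gradient h (lam i))
    <= Num.sqrt (2 * (h (lam 0%N) - h lam_star) / \sum_(i < k.+1) gamma i)
       + total_distortion eps.
Proof.
cbv zeta; set h := fun l => - dual_fun Y f l.
have hE i : enorm (gradient h (lam i)) = enorm (Amap (y i)).
  by rewrite (gradient_dual_fun hm Y_convex mu_gt0 f_strong (run i).1) enormN.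
have step i : gamma i * (enorm (gradient h (lam i)) ^+ 2
    - total_distortion eps ^+ 2) <= 2 * (h (lam i) - h (lam i.+1)).
  have [g0 gL] := gamma_bound i; have [ymin ->] := run i.
  have := inexact_step_descent hm Y_convex mu_gt0 f_strong (r i) ymin g0 gL.
  have : dotmx (Amap (r i)) (Amap (r i)) <= total_distortion eps ^+ 2.
    rewrite -enorm_sqr lerXn2r ?nnegrE ?enorm_ge0 ?sqrtr_ge0//.
    exact: enorm_Amap_le.
  rewrite hE enorm_sqr -(ler_pM2l g0) /h; lra.
have sums : \sum_(i < k.+1) gamma i * (enorm (gradient h (lam i)) ^+ 2
    - total_distortion eps ^+ 2) <= 2 * (h (lam 0%N) - h lam_star).
  (* The sum telescopes down to [h (lam k.+1)], which is at least [h lam_star]. *)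
  apply: (@le_trans _ _ (2 * (h (lam 0%N) - h (lam k.+1)))); last first.
    by have := lam_star_opt (lam k.+1); rewrite /h; lra.
  elim: k.+1 => [|j IH]; first by rewrite big_ord0 subrr mulr0.
  by rewrite big_ord_recr /=; have := step j; lra.
set M := \big[_/_]_(i < _) _; set S := \sum_(i < k.+1) gamma i in sums *.
have M0 : 0 <= M by apply: le_bigmin => [|i _]; exact: enorm_ge0.
have S0 : 0 < S.
  rewrite /S big_ord_recl ltr_pwDl ?(gamma_bound _).1//.
  by apply: sumr_ge0 => i _; rewrite ltW ?(gamma_bound _).1.
(* Each summand only decreases when its gradient norm is replaced by the minimum [M]. *)
have MS : (M ^+ 2 - total_distortion eps ^+ 2) * S
    <= 2 * (h (lam 0%N) - h lam_star).
  apply: le_trans sums; rewrite mulr_sumr; apply: ler_sum => i _.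
  rewrite mulrC ler_wpM2l ?(ltW (gamma_bound _).1)// lerD2r.
  rewrite lerXn2r ?nnegrE ?enorm_ge0//.
  exact: (bigmin_le _ i (fun i : 'I_k.+1 => enorm (gradient h (lam i)))).
(* Optimality of [lam_star] makes the radicand nonnegative, so squaring undoes the square root. *)
have h0 : 0 <= 2 * (h (lam 0%N) - h lam_star) / S.
  by rewrite divr_ge0 ?(ltW S0)//; have := lam_star_opt (lam 0%N); rewrite /h; lra.
rewrite -ler_pdivlMr// in MS.
have E0 : 0 <= total_distortion eps by exact: sqrtr_ge0.
have q0 := sqrtr_ge0 (2 * (h (lam 0%N) - h lam_star) / S).
(* With [q] the square root and [E] the distortion, [M^2 <= q^2 + E^2 <= (q + E)^2] since [q E] is
   nonnegative. *)
rewrite -(@ler_pXn2r _ 2) ?nnegrE ?addr_ge0// sqrrD sqr_sqrtr//.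
by have := mulr_ge0 q0 E0; lra.
Qed.
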